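(* Let $A\in\mathbb{R}^{N\times N}$ be a rank-$r$ HODLR matrix with cluster tree $\mathcal{T}_L$, all of whose off-diagonal blocks have the same rank $r$ and all of whose diagonal blocks have the same size $m=N/2^L$. Then the solution of $Ax=b$ for an arbitrary right-hand side $b$ using the factorization of $A$, by the solution algorithm described in the context, requires (under the counting convention described there) the following amount of operations: $$t_s=2mN+\sum_{\ell=1}^{L}4rN=2mN+4rNL=\mathcal{O}(rN\log N),$$ where the asymptotic bound is for $m$ a constant independent of $N$ (so that $L=\mathcal{O}(\log N)$).
   Context: Cluster tree: given $\mathcal{I}=\{1,\dots,N\}$, a cluster tree $\mathcal{T}_L$ is a binary tree with levels $0,1,\dots,L$ and $2^\ell$ nodes at level $\ell$, in which every node $\nu$ stands for a nonempty consecutive subset $\mathcal{I}_\nu\subseteq\mathcal{I}$, the root stands for $\mathcal{I}$, and the subsets of two siblings partition the subset of their parent. HODLR matrix: $A$ is a HODLR matrix with respect to $\mathcal{T}_L$ if for every pair of siblings $\alpha,\beta$ in $\mathcal{T}_L$ the off-diagonal block $A(\mathcal{I}_\alpha,\mathcal{I}_\beta)$ has low rank, written $A(\mathcal{I}_\alpha,\mathcal{I}_\beta)=U_\alpha V_\beta^*$ with $U_\alpha$ and $V_\beta$ having $r$ columns. The diagonal blocks are $D_\alpha=A(\mathcal{I}_\alpha,\mathcal{I}_\alpha)$ for the $2^L$ leaf nodes $\alpha$, each of size $m\times m$. Factorization (precomputed and given): the LU factorizations of all diagonal blocks $D_\alpha$; the matrices $Y_\nu=A(\mathcal{I}_\nu,\mathcal{I}_\nu)^{-1}U_\nu$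 for all non-root nodes $\nu$ (each with $r$ columns); and the LU factorizations of the $2r\times2r$ matrices $K_\gamma=\begin{pmatrix} V_\alpha^*Y_\alpha & I \\ I & V_\beta^*Y_\beta \end{pmatrix}$ for all non-leaf nodes $\gamma$ with children $\alpha,\beta$. Solution algorithm. Set $x\gets b$. (1) For each leaf $\alpha$: $x(\mathcal{I}_\alpha)\gets D_\alpha^{-1}x(\mathcal{I}_\alpha)$ using the stored LU factorization. (2) For $\ell=L-1,\dots,0$ and each node $\gamma$ at level $\ell$ with children $\alpha,\beta$: solve, with the stored LU factorization, $K_\gamma\begin{pmatrix} w_\alpha \\ w_\beta \end{pmatrix}=\begin{pmatrix} V_\alpha^*x(\mathcal{I}_\alpha) \\ V_\beta^*x(\mathcal{I}_\beta) \end{pmatrix}$ and update $x(\mathcal{I}_\gamma)\gets x(\mathcal{I}_\gamma)-\begin{pmatrix} Y_\alpha w_\alpha \\ Y_\beta w_\beta \end{pmatrix}$. Counting convention: solving one right-hand side with the LU factorization of an $m\times m$ matrix costs $2m^2$ operations; multiplying an $n\times k$ real matrix by a vector costs $2nk$ operations. The rank $r$ is assumed small, so in step (2) the cost is taken to be dominated by the matrix-vector products forming the right-hand sides and the updates (the cost of the solves with the small matrices $K_\gamma$ is neglected). For each level $\ell$ with $1\le\ell\le L$ (the level of the children $\alpha,\beta$) these are $2rN$ operations for the right-hand sides plus $2rN$ operations for the updates. *)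

(* Defs.v *)
From HB Require Import structures.
From mathcomp Require Import all_boot all_order all_algebra all_fingroup.
From mathcomp Require Import reals.
Set Implicit Arguments.
Unset Strict Implicit.
Unset Printing Implicit Defensive.
Import GRing.Theory.
Local Open Scope ring_scope.

(* The node [(l, j)] is the [j]-th of the [2 ^ l] nodes at level [l]; its
   children are [(l.+1, 2 j)] and [(l.+1, 2 j + 1)]. *)
Definition node := (nat * nat)%type.

Definition is_node (L : nat) (nu : node) : bool :=
  ((nu.1 <= L) && (nu.2 < 2 ^ nu.1))%N.
Definition is_leaf (L : nat) (nu : node) : bool :=
  is_node L nu && (nu.1 == L).
Definition is_inner (L : nat) (nu : node) : bool :=
  is_node L nu && (nu.1 < L)%N.

Definition root_node : node := (0%N, 0%N).
Definition child (gamma : node) (c : bool) : node :=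
  (gamma.1.+1, gamma.2.*2 + c)%N.

Definition level_nodes (l : nat) : seq node :=
  [seq (l, j) | j <- iota 0 (2 ^ l)].

(* The values of [cluster] outside the nodes of levels [0, ..., L] are
   irrelevant. The index set {1, ..., N} is rendered as ['I_N]. *)
Record cluster_tree (N L : nat) := ClusterTree {
  cluster :> node -> {set 'I_N};
  cluster_neq0 : forall nu, is_node L nu -> cluster nu != set0;
  cluster_consecutive : forall nu, is_node L nu ->
    exists a b : nat, cluster nu = [set i : 'I_N | (a <= i < b)%N];
  cluster_root : cluster root_node = [set: 'I_N];
  cluster_cover : forall gamma, is_inner L gamma ->
    cluster (child gamma false) :|: cluster (child gamma true) = cluster gamma;
  cluster_disjoint : forall gamma, is_inner L gamma ->
    [disjoint cluster (child gamma false) & cluster (child gamma true)]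
}.

(* A(I, J), with rows and columns in increasing order of their index. *)
Definition submx_of (R : Type) (N : nat) (A : 'M[R]_N) (I J : {set 'I_N}) :
    'M[R]_(#|I|, #|J|) :=
  mxsub (fun i : 'I_#|I| => enum_val i) (fun j : 'I_#|J| => enum_val j) A.

Definition subvec (R : Type) (N : nat) (x : 'cV[R]_N) (I : {set 'I_N}) :
    'cV[R]_#|I| :=
  rowsub (fun i : 'I_#|I| => enum_val i) x.

(* The vector x after x(I) <- y; the index [k], when it exists, is unique. *)
Definition assign (R : Type) (N : nat) (x : 'cV[R]_N) (I : {set 'I_N})
    (y : 'cV[R]_#|I|) : 'cV[R]_N :=
  \col_i (if [pick k : 'I_#|I| | enum_val k == i] is Some k
          then y k ord0 else x i ord0).

(* [child gamma c] and [child gamma (~~ c)] range over the ordered pairs of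
   siblings. *)
Definition hodlr (R : fieldType) (N L : nat) (T : cluster_tree N L) (r : nat)
    (A : 'M[R]_N) : Prop :=
  forall gamma, is_inner L gamma -> forall c : bool,
    \rank (submx_of A (T (child gamma c)) (T (child gamma (~~ c)))) = r.

(* LU factorization, row interchanges being allowed. *)
Record lu (R : Type) (n : nat) := LU {
  lu_perm : 'S_n;
  lu_low : 'M[R]_n;
  lu_up : 'M[R]_n
}.

Definition is_lu (R : fieldType) (n : nat) (M : 'M[R]_n) (F : lu R n) : Prop :=
  [/\ is_trig_mx (lu_low F),
      forall i, lu_low F i i = 1,
      is_trig_mx (lu_up F)^T &
      perm_mx (lu_perm F) *m M = lu_low F *m lu_up F].

(* The stored quantities; only the entries constrained by
   [is_hodlr_factorization] below are meaningful. *)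
Record hodlr_data (R : Type) (N L : nat) (T : cluster_tree N L) (r : nat) :=
  HodlrData {
    hU : forall nu : node, 'M[R]_(#|T nu|, r);
    hV : forall nu : node, 'M[R]_(#|T nu|, r);
    hY : forall nu : node, 'M[R]_(#|T nu|, r);
    luD : forall nu : node, lu R #|T nu|;
    luK : node -> lu R (r + r)
  }.

Definition Kmx (R : fieldType) (N L : nat) (T : cluster_tree N L) (r : nat)
    (F : hodlr_data R T r) (gamma : node) : 'M[R]_(r + r) :=
  let alpha := child gamma false in
  let beta := child gamma true in
  block_mx ((hV F alpha)^T *m hY F alpha) 1%:M
           1%:M                           ((hV F beta)^T *m hY F beta).

(* The invertibility requirements are those implicit in writing inverses and
   in solving with the stored LU factorizations. *)
Record is_hodlr_factorization (R : fieldType) (N L : nat)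
    (T : cluster_tree N L) (r : nat) (A : 'M[R]_N) (F : hodlr_data R T r) :
    Prop := IsHodlrFactorization {
  fact_UV : forall gamma, is_inner L gamma -> forall c : bool,
    submx_of A (T (child gamma c)) (T (child gamma (~~ c))) =
      hU F (child gamma c) *m (hV F (child gamma (~~ c)))^T;
  fact_D : forall alpha, is_leaf L alpha ->
    submx_of A (T alpha) (T alpha) \in unitmx /\
    is_lu (submx_of A (T alpha) (T alpha)) (luD F alpha);
  fact_Y : forall nu, is_node L nu -> nu != root_node ->
    submx_of A (T nu) (T nu) \in unitmx /\
    hY F nu = invmx (submx_of A (T nu) (T nu)) *m hU F nu;
  fact_K : forall gamma, is_inner L gamma ->
    Kmx F gamma \in unitmx /\ is_lu (Kmx F gamma) (luK F gamma)
}.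

(* A result together with the number of operations charged for it. *)
Definition counted (X : Type) := (X * nat)%type.

Definition cret (X : Type) (x : X) : counted X := (x, 0%N).

Definition cbind (X Y : Type) (c : counted X) (f : X -> counted Y) :
    counted Y :=
  let d := f c.1 in (d.1, (c.2 + d.2)%N).

Notation "x <-- c ;; d" := (cbind c (fun x => d))
  (at level 100, c at next level, right associativity).

Fixpoint cfor (X Y : Type) (f : X -> Y -> counted X) (x : X) (s : seq Y) :
    counted X :=
  if s is y :: s' then x' <-- f x y ;; cfor f x' s' else cret x.

Definition neglect_cost (X : Type) (c : counted X) : counted X := (c.1, 0%N).

(* The charges in the next two definitions are conventions: 2 n^2 for solving
   one right-hand side, 2 n k for an n x k matrix times a vector. *)
Definition lu_solve (R : fieldType) (n : nat) (F : lu R n) (y : 'cV[R]_n) :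
    counted 'cV[R]_n :=
  (invmx (lu_up F) *m (invmx (lu_low F) *m (perm_mx (lu_perm F) *m y)),
   2 * n ^ 2)%N.

Definition matvec (R : fieldType) (n k : nat) (B : 'M[R]_(n, k))
    (y : 'cV[R]_k) : counted 'cV[R]_n :=
  (B *m y, 2 * n * k)%N.

Section Solve.
Variables (R : fieldType) (N L : nat) (T : cluster_tree N L) (r : nat).
Variable F : hodlr_data R T r.

Definition leaf_step (x : 'cV[R]_N) (alpha : node) : counted 'cV[R]_N :=
  y <-- lu_solve (luD F alpha) (subvec x (T alpha)) ;;
  cret (assign x y).

(* The solve with K_gamma is not charged, nor are vector subtractions: only
   the four matrix-vector products count. *)
Definition inner_step (x : 'cV[R]_N) (gamma : node) : counted 'cV[R]_N :=
  let alpha := child gamma false in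
  let beta := child gamma true in
  ra <-- matvec (hV F alpha)^T (subvec x (T alpha)) ;;
  rb <-- matvec (hV F beta)^T (subvec x (T beta)) ;;
  w <-- neglect_cost (lu_solve (luK F gamma) (col_mx ra rb)) ;;
  ya <-- matvec (hY F alpha) (usubmx w) ;;
  yb <-- matvec (hY F beta) (dsubmx w) ;;
  cret (assign (assign x (subvec x (T alpha) - ya))
               (subvec x (T beta) - yb)).

Definition hodlr_solve (b : 'cV[R]_N) : counted 'cV[R]_N :=
  x <-- cfor leaf_step b (level_nodes L) ;;
  cfor (fun x' l => cfor inner_step x' (level_nodes l)) x (rev (iota 0 L)).

End Solve.

(* Main.v *)
(** After level [l] has been processed, the restriction of [x] to each cluster
    [I] of level [l] solves [A(I, I) x(I) = b(I)]. If [alpha], [beta] are the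
    children of [gamma], the solution for [gamma] is [x(alpha) - Y_alpha w_alpha],
    [x(beta) - Y_beta w_beta], where the second block row of the [K_gamma] system
    says that [V_beta^T (x(beta) - Y_beta w_beta) = w_alpha], so that in the rows
    of [alpha] the off-diagonal contribution [U_alpha w_alpha] cancels
    [A(alpha, alpha) Y_alpha w_alpha]; likewise for [beta]. The clusters of one
    level are disjoint, so the steps on a level do not interfere. All clusters of
    level [l] have [m 2^(L - l)] elements, hence each level costs [4 r N]. Since
    [N >= 2^L], [L <= ln N / ln 2]. *)
Require Import Defs.
From mathcomp Require Import all_boot all_order all_algebra.
From mathcomp Require Import reals exp.
From mathcomp Require Import zify ring.
Import Order.TTheory GRing.Theory Num.Theory.
Local Open Scope ring_scope.

(** * Invariants and cost of counted loops *)

Section Cfor.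
Variables (X : Type) (Y : eqType) (f : X -> Y -> counted X).

Lemma cfor_inv (P : X -> Prop) (s : seq Y) (x : X) :
  (forall y z, y \in s -> P z -> P (f z y).1) -> P x -> P (cfor f x s).1.
Proof.
elim: s x => [|y s IHs] x //= Pf Px.
apply: IHs => [z t zs|]; first by apply: Pf; rewrite inE zs orbT.
by apply: Pf Px; rewrite inE eqxx.
Qed.

(** [P y] is the precondition and [Q y] the postcondition of the step at [y]. Each element has
    exactly one turn: the steps before it keep [P y], the steps after it keep [Q y]. Uniqueness of
    [s] makes all those other steps concern elements distinct from [y]. *)
Lemma cfor_each (P Q : Y -> X -> Prop) (s : seq Y) (x : X) :
  uniq s ->
  (forall y z, y \in s -> P y z -> Q y (f z y).1) ->
  (forall y y' z, y \in s -> y' \in s -> y != y' -> P y' z -> P y' (f z y).1) ->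
  (forall y y' z, y \in s -> y' \in s -> y != y' -> Q y' z -> Q y' (f z y).1) ->
  (forall y, y \in s -> P y x) ->
  forall y, y \in s -> Q y (cfor f x s).1.
Proof.
elim: s x => [|y s IHs] x //= /andP[ys us] PQ keepP keepQ Px y'.
have sub z : z \in s -> z \in y :: s by move=> zs; rewrite inE zs orbT.
have hd : y \in y :: s by rewrite inE eqxx.
have neq z : z \in s -> y != z by apply: contraTneq => <-.
rewrite inE => /predU1P[->|y's].
  apply: (@cfor_inv (Q y)) => [z t zs|].
    by apply: keepQ => //; [exact: sub | rewrite eq_sym neq].
  by apply: PQ (Px _ _).
apply: IHs y' y's => //.
- by move=> z t /sub; apply: PQ.
- by move=> z z' t /sub zs /sub; apply: keepP.
- by move=> z z' t /sub zs /sub; apply: keepQ.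
- by move=> z zs; apply: keepP (Px _ (sub _ zs)) => //; [exact: sub | exact: neq].
Qed.

Lemma cfor_cost (c : Y -> nat) (s : seq Y) (x : X) :
  (forall y z, y \in s -> (f z y).2 = c y) ->
  (cfor f x s).2 = (\sum_(y <- s) c y)%N.
Proof.
elim: s x => [|y s IHs] x fc /=; first by rewrite big_nil.
rewrite big_cons fc ?inE ?eqxx // IHs // => z t zs.
by rewrite fc // inE zs orbT.
Qed.

End Cfor.

(** * Linear systems restricted to index sets *)

Section Subvectors.
Variables (R : fieldType) (N : nat).
Implicit Types (A : 'M[R]_N) (x b : 'cV[R]_N) (I J : {set 'I_N}).

Lemma submx_mulE A x I J (k : 'I_#|I|) :
  (submx_of A I J *m subvec x J) k ord0 =
  \sum_(j in J) A (enum_val k) j * x j ord0.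
Proof. by rewrite mxE [RHS]big_enum_val; apply: eq_bigr => j _; rewrite !mxE. Qed.

Definition solves_on A b I x : Prop :=
  submx_of A I I *m subvec x I = subvec b I.

Lemma eq_subvec x x' I :
  {in I, forall i, x i ord0 = x' i ord0} -> subvec x I = subvec x' I.
Proof.
by move=> eqx; apply/colP => k; rewrite !mxE eqx // enum_valP.
Qed.

(** The two hypotheses are the block rows of the system on the union. They are compared entrywise,
    as sums over index sets, which avoids reordering [I :|: J] into a block matrix. *)
Lemma solves_onU A b I J x :
  [disjoint I & J] ->
  submx_of A I I *m subvec x I + submx_of A I J *m subvec x J = subvec b I ->
  submx_of A J J *m subvec x J + submx_of A J I *m subvec x I = subvec b J ->
  solves_on A b (I :|: J) x.
Proof.
move=> dIJ solI solJ; apply/colP => k; rewrite submx_mulE mxE.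
rewrite (eq_bigl [predU I & J]) => [|j]; last by rewrite !inE.
rewrite bigU //=; have := enum_valP k.
set i := enum_val k => /setUP[iI|iJ].
  move/colP/(_ (enum_rank_in iI i)): solI.
  by rewrite mxE !submx_mulE mxE enum_rankK_in.
rewrite addrC; move/colP/(_ (enum_rank_in iJ i)): solJ.
by rewrite mxE !submx_mulE mxE enum_rankK_in.
Qed.

Lemma subvec_assign x I (y : 'cV[R]_#|I|) : subvec (assign x y) I = y.
Proof.
apply/colP => k; rewrite !mxE; case: pickP => [k'|/(_ k)]; last by rewrite eqxx.
by move/eqP/enum_val_inj->.
Qed.

Lemma assign_out x I (y : 'cV[R]_#|I|) i :
  i \notin I -> assign x y i ord0 = x i ord0.
Proof.
move=> iI; rewrite mxE; case: pickP => // k /eqP ik.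
by rewrite -ik enum_valP in iI.
Qed.

Lemma subvec_assign_disjoint x I J (y : 'cV[R]_#|I|) :
  [disjoint J & I] -> subvec (assign x y) J = subvec x J.
Proof.
by move=> dJI; apply: eq_subvec => i iJ; rewrite assign_out // (disjointFr dJI).
Qed.

End Subvectors.

Arguments solves_on {R N}.

(** The product of the triangular factors is a row permutation of the invertible [M], so both
    factors are invertible and the inverses in [lu_solve] cancel. *)
Lemma lu_solveK (R : fieldType) (n : nat) (M : 'M[R]_n) (F : lu R n)
    (y : 'cV[R]_n) :
  M \in unitmx -> is_lu M F -> M *m (lu_solve F y).1 = y.
Proof.
case=> Mu [_ _ _ PM] /=.
have /andP[Lu Uu] : (lu_low F \in unitmx) && (lu_up F \in unitmx).
  by rewrite -unitmx_mul -PM unitmx_mul unitmx_perm.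
apply: (can_inj (mulKmx (unitmx_perm R (lu_perm F)))).
by rewrite [LHS]mulmxA PM -mulmxA !mulKVmx.
Qed.

(** * Levels, parents and children *)

Lemma mem_level_nodes (l : nat) (nu : node) :
  (nu \in level_nodes l) = (nu.1 == l) && (nu.2 < 2 ^ l)%N.
Proof.
case: nu => k j /=; apply/mapP/andP => [[j' + [-> ->]]|[/eqP-> ltj]].
  by rewrite mem_iota add0n.
by exists j; rewrite // mem_iota.
Qed.

Lemma uniq_level_nodes (l : nat) : uniq (level_nodes l).
Proof. by rewrite map_inj_uniq ?iota_uniq // => i j []. Qed.

Lemma size_level_nodes (l : nat) : size (level_nodes l) = (2 ^ l)%N.
Proof. by rewrite size_map size_iota. Qed.

Lemma child_level (l : nat) (gamma : node) (c : bool) :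
  gamma \in level_nodes l -> child gamma c \in level_nodes l.+1.
Proof.
rewrite !mem_level_nodes /= => /andP[/eqP-> lt_g].
by rewrite eqxx expnS; case: c; lia.
Qed.

Lemma child_exists (l : nat) (nu : node) :
  nu \in level_nodes l.+1 ->
  exists2 gamma, gamma \in level_nodes l & exists c, nu = child gamma c.
Proof.
case: nu => k j; rewrite mem_level_nodes /= expnS => /andP[/eqP-> ltj].
exists (l, j./2); first by rewrite mem_level_nodes /= eqxx; lia.
by exists (odd j); rewrite /child /= addnC odd_double_half.
Qed.

Lemma is_node_level (L l : nat) (nu : node) :
  (l <= L)%N -> nu \in level_nodes l -> is_node L nu.
Proof. by rewrite mem_level_nodes /is_node => lL /andP[/eqP-> ->]; rewrite lL. Qed.

Lemma is_leaf_level (L : nat) (nu : node) : nu \in level_nodes L -> is_leaf L nu.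
Proof.
move=> nuL; rewrite /is_leaf (@is_node_level L L) //=.
by move: nuL; rewrite mem_level_nodes => /andP[].
Qed.

Lemma is_inner_level (L l : nat) (nu : node) :
  (l < L)%N -> nu \in level_nodes l -> is_inner L nu.
Proof.
move=> lL nul; rewrite /is_inner (@is_node_level L l) ?(ltnW lL) //=.
by move: nul; rewrite mem_level_nodes => /andP[/eqP-> _].
Qed.

(** * Disjointness and size of clusters *)

Section Clusters.
Variables (N L : nat) (T : cluster_tree N L).

Lemma child_subset (gamma : node) (c : bool) :
  is_inner L gamma -> T (child gamma c) \subset T gamma.
Proof.
move=> /(cluster_cover T) <-.
by case: c; rewrite ?subsetUl ?subsetUr.
Qed.

(** Two distinct nodes on a level are either siblings, or have distinct parents whose disjoint
    clusters contain theirs. *)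
Lemma level_disjoint (l : nat) (mu nu : node) :
  (l <= L)%N -> mu \in level_nodes l -> nu \in level_nodes l -> mu != nu ->
  [disjoint T mu & T nu].
Proof.
elim: l mu nu => [|l IHl] mu nu lL.
  case: mu nu => [k i] [k' i']; rewrite !mem_level_nodes /= !expn0 !ltnS !leqn0.
  by move=> /andP[/eqP-> /eqP->] /andP[/eqP-> /eqP->]; rewrite eqxx.
move=> /child_exists[g gl [c ->]] /child_exists[h hl [d ->]].
have gi := is_inner_level _ _ _ lL gl; have hi := is_inner_level _ _ _ lL hl.
have [<-{h hl hi}|gh _] := eqVneq g h.
  have := cluster_disjoint T gi.
  by case: c d => [] [] //; rewrite ?eqxx // disjoint_sym.
apply: disjointWl (child_subset g c gi) _.
apply: disjointWr (child_subset h d hi) _.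
exact: IHl (ltnW lL) gl hl gh.
Qed.

Lemma card_cluster (m l : nat) (nu : node) :
  (forall alpha, is_leaf L alpha -> #|T alpha| = m) ->
  (l <= L)%N -> nu \in level_nodes l -> #|T nu| = (m * 2 ^ (L - l))%N.
Proof.
(* Induction on the height [L - l]: the sizes of two siblings, equal by induction, add up to that of
   their parent. *)
move=> leafm; move: {2}(L - l)%N (erefl (L - l)%N) => k.
elim: k l nu => [|k IHk] l nu Ek lL nul.
  have {}lL : l = L by lia.
  by rewrite lL in nul *; rewrite subnn muln1 leafm // is_leaf_level.
have lltL : (l < L)%N by lia.
have nui := is_inner_level _ _ _ lltL nul.
rewrite -(cluster_cover T nui) cardsU disjoint_setI0 ?cluster_disjoint //.
rewrite cards0 subn0 !(IHk l.+1) ?child_level //; try lia.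
have -> : (L - l)%N = (L - l.+1).+1 by lia.
by rewrite expnS; lia.
Qed.

Lemma leaf_size_gt0 (m : nat) :
  (forall alpha, is_leaf L alpha -> #|T alpha| = m) -> (0 < m)%N.
Proof.
have leaf0 : is_leaf L (L, 0%N).
  by rewrite is_leaf_level // mem_level_nodes /= eqxx expn_gt0.
move=> /(_ _ leaf0) <-; rewrite card_gt0.
by apply: cluster_neq0; case/andP: leaf0.
Qed.

End Clusters.

(** * Correctness and cost of the solver *)

Section Solution.
Variables (R : fieldType) (N L r : nat) (T : cluster_tree N L).
Variables (A : 'M[R]_N) (F : hodlr_data R T r) (b : 'cV[R]_N).

Lemma leaf_step_out (x : 'cV[R]_N) (alpha : node) (i : 'I_N) :
  i \notin T alpha -> (leaf_step F x alpha).1 i ord0 = x i ord0.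
Proof. exact: assign_out. Qed.

Lemma inner_step_out (x : 'cV[R]_N) (gamma : node) (i : 'I_N) :
  is_inner L gamma -> i \notin T gamma ->
  (inner_step F x gamma).1 i ord0 = x i ord0.
Proof.
move=> gi; rewrite -(cluster_cover T gi) inE negb_or => /andP[ia ib].
by rewrite /inner_step /= !assign_out.
Qed.

Lemma leaf_step_solves (x : 'cV[R]_N) (alpha : node) :
  is_hodlr_factorization A F -> is_leaf L alpha ->
  subvec x (T alpha) = subvec b (T alpha) ->
  solves_on A b (T alpha) (leaf_step F x alpha).1.
Proof.
move=> fF al xb; have [Du Dlu] := fact_D fF al.
rewrite /solves_on /leaf_step; set y := lu_solve _ _.
by rewrite /= subvec_assign lu_solveK.
Qed.

Lemma inner_step_solves (x : 'cV[R]_N) (gamma : node) :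
  is_hodlr_factorization A F -> is_inner L gamma ->
  (forall c, solves_on A b (T (child gamma c)) x) ->
  solves_on A b (T gamma) (inner_step F x gamma).1.
Proof.
move=> fF gi xsol.
have dab := cluster_disjoint T gi.
have Ynode c : is_node L (child gamma c).
  case/andP: gi; rewrite /is_node /= => /andP[_ lt2] ->.
  by rewrite expnS; case: c; lia.
have YE c : submx_of A (T (child gamma c)) (T (child gamma c)) *m
    hY F (child gamma c) = hU F (child gamma c).
  by have [Au ->] := fact_Y fF (Ynode c) isT; rewrite mulKVmx.
have [Ku Klu] := fact_K fF gi.
pose a := child gamma false; pose b' := child gamma true.
pose w := (lu_solve (luK F gamma)
  (col_mx ((hV F a)^T *m subvec x (T a)) ((hV F b')^T *m subvec x (T b')))).1.
have -> : (inner_step F x gamma).1 =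
    assign (assign x (subvec x (T a) - hY F a *m usubmx w))
      (subvec x (T b') - hY F b' *m dsubmx w) by [].
have := lu_solveK _ _ _ _ (col_mx ((hV F a)^T *m subvec x (T a))
  ((hV F b')^T *m subvec x (T b'))) Ku Klu.
(* Splitting [w] into its halves turns the [K_gamma] system into the block rows [Ka] and [Kb]. *)
rewrite -/w /Kmx -/a -/b' -{1}[w]vsubmxK mul_block_col !mul1mx.
move=> /eq_col_mx[Ka Kb].
rewrite -(cluster_cover T gi) -/a -/b'.
set ya := hY F a *m _; set yb := hY F b' *m _.
(* The second assignment writes on the sibling cluster only, so it leaves the first one intact. *)
have xa' : subvec (assign (assign x (subvec x (T a) - ya))
    (subvec x (T b') - yb)) (T a) = subvec x (T a) - ya.
  by rewrite subvec_assign_disjoint // subvec_assign.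
apply: solves_onU => //; rewrite xa' subvec_assign.
  (* Rows of [a]: [Kb] reduces the product of [V_b'^T] with the updated vector to [usubmx w], which
     cancels the correction [U_a *m usubmx w]. *)
  rewrite mulmxBr (xsol false) mulmxA YE (fact_UV fF gi false) -mulmxA.
  rewrite [_ *m (subvec x _ - _)]mulmxBr -Kb mulmxA addrK.
  by rewrite subrK.
(* Rows of [b']: the same with [Ka] and [dsubmx w]. *)
rewrite mulmxBr (xsol true) mulmxA YE (fact_UV fF gi true) -mulmxA.
rewrite [_ *m (subvec x _ - _)]mulmxBr -Ka mulmxA.
by rewrite [_ + dsubmx w]addrC addrK subrK.
Qed.

Lemma inner_level_solves (x : 'cV[R]_N) (l : nat) :
  is_hodlr_factorization A F -> (l < L)%N ->
  (forall nu, nu \in level_nodes l.+1 -> solves_on A b (T nu) x) ->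
  forall nu, nu \in level_nodes l ->
  solves_on A b (T nu) (cfor (inner_step F) x (level_nodes l)).1.
Proof.
move=> fF lL xsol.
(* Allowing any [I] inside [T y'] covers both the children of [y'] (precondition) and [y'] itself
   (postcondition). *)
have keep y y' (z : 'cV[R]_N) (I : {set 'I_N}) : y \in level_nodes l ->
    y' \in level_nodes l -> y != y' -> I \subset T y' ->
    solves_on A b I z -> solves_on A b I (inner_step F z y).1.
  move=> yl y'l neq_y Iy'; rewrite /solves_on.
  rewrite (eq_subvec _ _ _ (inner_step F z y).1) // => i /(subsetP Iy') iy'.
  rewrite inner_step_out //; first exact: is_inner_level yl.
  by rewrite (disjointFl (level_disjoint _ _ _ _ _ _ (ltnW lL) yl y'l neq_y)).
apply: (cfor_each _ _ _
  (fun nu z => forall c, solves_on A b (T (child nu c)) z)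
  (fun nu => solves_on A b (T nu))).
- exact: uniq_level_nodes.
- by move=> y z /(is_inner_level _ _ _ lL) yi; apply: inner_step_solves.
- move=> y y' z yl y'l neq_y zsol c; apply: (keep y y') => //.
  exact: child_subset (is_inner_level _ _ _ lL y'l).
- by move=> y y' z yl y'l neq_y; apply: (keep y y').
- by move=> y yl c; apply/xsol/child_level.
Qed.

Lemma hodlr_solve_correct :
  is_hodlr_factorization A F -> A *m (hodlr_solve F b).1 = b.
Proof.
move=> fF.
suff rootsol : solves_on A b (T root_node) (hodlr_solve F b).1.
  apply/colP => i; have iT : i \in T root_node by rewrite cluster_root inE.
  move/colP/(_ (enum_rank_in iT i)): rootsol.
  rewrite submx_mulE !mxE enum_rankK_in // cluster_root => <-.
  by apply: eq_bigl => j; rewrite inE.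
(* Generalized to the [k] levels still to be processed, those below [k], once all systems of level
   [k] are solved. *)
have rootP k x : (k <= L)%N ->
    (forall nu, nu \in level_nodes k -> solves_on A b (T nu) x) ->
    solves_on A b (T root_node)
      (cfor (fun x' l => cfor (inner_step F) x' (level_nodes l)) x
        (rev (iota 0 k))).1.
  elim: k x => [|k IHk] x kL xsol; first exact: xsol.
  have -> : rev (iota 0 k.+1) = k :: rev (iota 0 k).
    by rewrite -(addn1 k) iotaD rev_cat.
  by apply: IHk (ltnW kL) _; apply: inner_level_solves.
apply: (rootP L) => // nu; move: nu.
(* Until its turn, a leaf cluster still carries the entries of [b]. *)
apply: (cfor_each _ _ _
  (fun nu (x : 'cV[R]_N) => subvec x (T nu) = subvec b (T nu))
  (fun nu => solves_on A b (T nu))) => //.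
- exact: uniq_level_nodes.
- by move=> y z /is_leaf_level; apply: leaf_step_solves.
- move=> y y' z yL y'L neq_y <-; apply: eq_subvec => i iy'.
  by rewrite leaf_step_out // (disjointFl (level_disjoint _ _ _ _ _ _ _ yL y'L neq_y)).
move=> y y' z yL y'L neq_y; rewrite /solves_on.
rewrite (eq_subvec _ _ z (leaf_step F z y).1) // => i iy'.
by rewrite leaf_step_out // (disjointFl (level_disjoint _ _ _ _ _ _ _ yL y'L neq_y)).
Qed.

Lemma hodlr_solve_cost (m : nat) :
  (forall alpha, is_leaf L alpha -> #|T alpha| = m) ->
  N = (m * 2 ^ L)%N ->
  (hodlr_solve F b).2 = (2 * m * N + 4 * r * N * L)%N.
Proof.
move=> leafm NE; rewrite /hodlr_solve /=; congr addn.
  (* The [2 ^ L] leaves cost [2 * m ^ 2] each, and [m * 2 ^ L] is [N]. *)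
  rewrite (cfor_cost _ _ _ (fun=> 2 * m ^ 2)%N) => [|y z /is_leaf_level yL].
    rewrite big_const_seq count_predT size_level_nodes iter_addn_0 NE; lia.
  by rewrite /= leafm // addn0.
rewrite (cfor_cost _ _ _ (fun=> 4 * r * N)%N) => [|l x].
  by rewrite big_const_seq count_predT size_rev size_iota iter_addn_0.
rewrite mem_rev mem_iota add0n => lL.
rewrite (cfor_cost _ _ _ (fun=> 4 * r * (m * 2 ^ (L - l)))%N) => [|y z yl].
  rewrite big_const_seq count_predT size_level_nodes iter_addn_0 NE.
  by rewrite -{2}(subnK (ltnW lL)) expnD; lia.
(* Each of the two children takes part in two products of cost [2 * r * (m * 2 ^ (L - l.+1))], and
   twice the size of a child is the size of the parent. *)
rewrite /= !(card_cluster _ _ _ m l.+1) ?child_level //.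
by rewrite -(subnSK lL) expnS; lia.
Qed.

End Solution.

(** * The asymptotic bound *)

Lemma le_ln_exp2 (R : realType) (m L : nat) :
  (0 < m)%N -> L%:R * ln 2 <= ln (m * 2 ^ L)%:R :> R.
Proof.
move=> m0; rewrite mulr_natl -lnXn // -natrX.
rewrite ler_ln ?posrE ?ltr0n ?muln_gt0 ?expn_gt0 ?m0 //.
by rewrite ler_nat leq_pmull.
Qed.

Theorem theorem4 (R : realType) (m : nat) :
  (forall (N L r : nat) (T : cluster_tree N L) (A : 'M[R]_N)
          (F : hodlr_data R T r) (b : 'cV[R]_N),
     (forall alpha, is_leaf L alpha -> #|T alpha| = m) ->
     N = (m * 2 ^ L)%N ->
     hodlr T r A ->
     is_hodlr_factorization A F ->
     [/\ A *m (hodlr_solve F b).1 = b,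
         (hodlr_solve F b).2 =
           (2 * m * N + \sum_(1 <= l < L.+1) 4 * r * N)%N &
         (2 * m * N + \sum_(1 <= l < L.+1) 4 * r * N)%N =
           (2 * m * N + 4 * r * N * L)%N])
  /\
  (exists (C : R) (N0 : nat),
     forall (N L r : nat) (T : cluster_tree N L) (A : 'M[R]_N)
            (F : hodlr_data R T r) (b : 'cV[R]_N),
     (forall alpha, is_leaf L alpha -> #|T alpha| = m) ->
     N = (m * 2 ^ L)%N ->
     hodlr T r A ->
     is_hodlr_factorization A F ->
     (N0 <= N)%N ->
     L%:R <= C * ln N%:R /\
     ((0 < r)%N ->
      ((hodlr_solve F b).2)%:R <= C * (r%:R * N%:R * ln N%:R))).
Proof.
split=> [N L r T A F b leafm NE _ fF|].
  have sumE : (\sum_(1 <= l < L.+1) 4 * r * N = 4 * r * N * L)%N.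
    by rewrite sum_nat_const_nat subn1 mulnC.
  by rewrite sumE; split=> //; [exact: hodlr_solve_correct | exact: hodlr_solve_cost].
have ln2_gt0 : 0 < ln 2 :> R by rewrite ln_gt0 // ltr1n.
(* With [t = ln N / ln 2] one has [L <= t], and [N >= 2] gives [1 <= t]. For [r >= 1] the leaf term
   is at most [2 m r N t] and the level terms at most [4 r N t]; the sum of the coefficients,
   divided by [ln 2], is the constant. *)
exists ((2 * m + 4)%:R / ln 2), 2%N => N L r T A F b leafm NE _ _ N2.
have L_le : L%:R <= ln N%:R / ln 2 :> R.
  by rewrite ler_pdivlMr // NE le_ln_exp2 // (leaf_size_gt0 _ _ T).
have one_le : 1 <= ln N%:R / ln 2 :> R.
  by rewrite ler_pdivlMr // mul1r ler_ln ?posrE ?ltr0n ?ler_nat // (leq_trans _ N2).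
rewrite [_ / ln 2 * _]mulrAC -mulrA; set t := ln N%:R / ln 2 in L_le one_le *.
split=> [|r0].
  apply: le_trans L_le _; rewrite ler_peMl ?(le_trans ler01) //.
  by rewrite ler1n addn_gt0 orbT.
rewrite (hodlr_solve_cost _ _ _ _ _ _ _ m) //.
have -> : (2 * m + 4)%:R / ln 2 * (r%:R * N%:R * ln N%:R) =
    (2 * m * r * N)%:R * t + (4 * r * N)%:R * t :> R.
  by rewrite /t !natrM natrD natrM; ring.
rewrite natrD natrM lerD //.
  (* The leaf term has neither [r] nor a logarithm: the first is supplied by [1 <= r], the second by
     [1 <= t]. *)
  apply: le_trans (_ : (2 * m * r * N)%:R <= _); last by rewrite ler_peMr.
  by rewrite -natrM ler_nat; nia.
by rewrite natrM ler_wpM2l.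
Qed.
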